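(* Let $\mathbb{K}$ be a field, $n \in \mathbb{N}$, and let $X = X_1 \times\cdots\times X_n$, $Y = Y_1 \times \cdots \times Y_n$ with $X_i, Y_i$ finite subsets of $\mathbb{K}$ and $Y_i \subseteq X_i$ for all $i$; let $P := X \setminus Y$. Let $f \in \mathbb{K}[x_1,\ldots,x_n]$, for each $i$ let $a_i := |X_i|$ and $b_i := |Y_i|$, and let $\le_a$ be an admissible monomial ordering. Let $g \in \mathbb{I}(P) + \langle f\rangle$ with $\mathrm{Lm}(g) = x_1^{e_1}\cdots x_n^{e_n}$ and $e_i < a_i$ for all $i$. Then \[ |P \setminus \mathbb{V}(f)| \ge \prod_{i=1}^n (a_i - e_i) - \prod_{i=1}^n \min(b_i, a_i - e_i). \]
   Context: $\mathbb{I}(P)$ is the ideal of polynomials vanishing on $P$, $\langle f\rangle$ the ideal generated by $f$, and $\mathbb{V}(f) := \{\mathbf{a}\in\mathbb{K}^n \mid f(\mathbf{a})=0\}$. An admissible ordering is a total order $\le_a$ on $\mathbb{N}_0^n$ with componentwise $\alpha\le\beta \Rightarrow \alpha \le_a \beta$ and $\alpha \le_a \beta \Rightarrow \alpha+\gamma\le_a\beta+\gamma$; $\mathrm{Lm}(g)$ is the monomial of the nonzero polynomial $g$ with $\le_a$-maximal exponent. *)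

(* Defs.v *)
From HB Require Import structures.
From mathcomp Require Import all_boot all_order all_algebra.
From mathcomp Require Import finmap mpoly.

Set Implicit Arguments.
Unset Strict Implicit.
Unset Printing Implicit Defensive.

Import Order.TTheory GRing.Theory Num.Theory.

Local Open Scope fset_scope.
Local Open Scope ring_scope.

(* Points of K^n are finite functions, so that sets of them can be finite sets
   over a choiceType. *)
Definition box (K : choiceType) (n : nat) (X : 'I_n -> {fset K}) :
    {fset {ffun 'I_n -> K}} :=
  [fset [ffun i => fsval ((h : {dffun forall i, X i}) i)]
    | h in {: {dffun forall i, X i}}].

Lemma in_box (K : choiceType) (n : nat) (X : 'I_n -> {fset K})
    (x : {ffun 'I_n -> K}) :
  reflect (forall i, x i \in X i) (x \in box X).
Proof.
apply: (iffP idP) => [/imfsetP[h _ ->] i|xX].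
  by rewrite ffunE; exact: fsvalP.
apply/imfsetP; exists ([ffun i => [` xX i]] : {dffun forall i, X i}) => //.
by apply/ffunP => i; rewrite !ffunE.
Qed.

Definition zero_locus (K : fieldType) (n : nat) (f : {mpoly K[n]}) :
    {pred {ffun 'I_n -> K}} :=
  [pred x : {ffun 'I_n -> K} | f.@[x] == 0].

Definition vanishing_ideal (K : fieldType) (n : nat)
    (P : {fset {ffun 'I_n -> K}}) (h : {mpoly K[n]}) : Prop :=
  forall x, x \in P -> h.@[x] = 0.

Definition principal_ideal (K : fieldType) (n : nat) (f h : {mpoly K[n]}) :
    Prop :=
  exists q, h = q * f.

Definition ideal_sum (K : fieldType) (n : nat) (I J : {mpoly K[n]} -> Prop)
    (g : {mpoly K[n]}) : Prop :=
  exists h k, [/\ I h, J k & g = h + k].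

(* The order (_ <= _)%MM on exponents is the componentwise one. *)
Record admissible (n : nat) (le : rel 'X_{1..n}) : Prop := Admissible {
  adm_refl : reflexive le;
  adm_anti : antisymmetric le;
  adm_trans : transitive le;
  adm_total : total le;
  adm_lepm : forall a b : 'X_{1..n}, (a <= b)%MM -> le a b;
  adm_add : forall a b c : 'X_{1..n}, le a b -> le (a + c)%MM (b + c)%MM
}.

(* Only a nonzero g, having a nonempty support, has a leading monomial. *)
Definition is_lead_monomial (K : fieldType) (n : nat) (le : rel 'X_{1..n})
    (g : {mpoly K[n]}) (e : 'X_{1..n}) : Prop :=
  e \in msupp g /\ forall m, m \in msupp g -> le m e.

(* Main.v *)
(* Where [f] vanishes on [P], so does [g], so it suffices to count the points
   [S] of [P] where [g] is nonzero. For every exponent [t] with [e <= t < a] and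
   not [t >= a - b], the product [g * 'X_[t - e]] has leading monomial [t] and
   is supported on [S] when restricted to [P]. Some [i] has [t i < a i - b i],
   so [P] contains a box whose sides have more than [t j] points: shrink [X i]
   to [X i \ Y i]. Hence a linear functional on functions on [P] kills every
   monomial not above [t] componentwise and takes the value 1 at [t]. Pairing
   these functionals with the products gives a matrix that is triangular for the
   monomial order, with nonzero diagonal, and of rank at most [#|S|]; the number
   of its rows is the claimed lower bound. *)
Require Import Defs.
From HB Require Import structures.
From mathcomp Require Import all_boot all_order all_algebra.
From mathcomp Require Import finmap mpoly.
From mathcomp Require Import zify.

Set Implicit Arguments.
Unset Strict Implicit.
Unset Printing Implicit Defensive.

Import Order.TTheory GRing.Theory Num.Theory.

Local Open Scope fset_scope.
Local Open Scope ring_scope.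

(** The Vandermonde matrix of the distinct points of [s] is invertible; column [k] of its inverse
    lists the weights. *)
Lemma moment_weights (K : fieldType) (s : seq K) (k : nat) :
  uniq s -> (k < size s)%N ->
  exists w : K -> K, forall j, (j < size s)%N ->
    \sum_(x <- s) w x * x ^+ j = (j == k)%:R.
Proof.
move=> s_uniq lt_ks; set N := size s.
pose V : 'M[K]_N := Vandermonde N (\row_i s`_i).
have Vunit : V \in unitmx.
  rewrite unitmxE det_Vandermonde unitfE; apply/prodf_neq0 => i _.
  apply/prodf_neq0 => j lt_ij.
  by rewrite !mxE subr_eq0 nth_uniq // gtn_eqF.
have [c VcE] : exists c, V *m c = delta_mx (Ordinal lt_ks) (0 : 'I_1).
  by exists (invmx V *m delta_mx (Ordinal lt_ks) 0); rewrite mulKVmx.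
(* For [x] in [s] this sum has a single term, the entry of [c] at the position of [x]. *)
exists (fun x => \sum_(i < N | i == index x s :> nat) c i 0) => j lt_js.
transitivity ((V *m c) (Ordinal lt_js) 0); last first.
  by rewrite VcE mxE eqxx andbT.
rewrite (big_nth 0) big_mkord mxE; apply: eq_bigr => i _.
by rewrite !mxE index_uniq // (big_pred1 i) // mulrC.
Qed.

(** The matrix of pairings factors through a space of dimension [#|S|], and its triangular shape
    makes its rows independent. *)
Lemma triangular_card (K : fieldType) (T J : finType) (D : {set T})
    (S : {set J}) (r : rel T) (u w : T -> J -> K) :
  reflexive r -> transitive r -> total r ->
  (forall t, t \in D -> \sum_(j in S) u t j * w t j != 0) ->
  (forall s t, s \in D -> t \in D -> r s t -> s != t ->
     \sum_(j in S) u s j * w t j = 0) ->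
  (#|D| <= #|S|)%N.
Proof.
move=> r_refl r_trans r_total diag upper.
pose A := \matrix_(i < #|D|, j < #|S|) u (enum_val i) (enum_val j).
pose B := \matrix_(j < #|S|, i < #|D|) w (enum_val i) (enum_val j).
have AB i k : (A *m B) i k = \sum_(j in S) u (enum_val i) j * w (enum_val k) j.
  by rewrite mxE [RHS]big_enum_val; apply: eq_bigr => j _; rewrite !mxE.
suff /eqP <- : row_free (A *m B).
  exact: leq_trans (mxrankM_maxl _ _) (rank_leq_col _).
apply: inj_row_free => v vAB0; apply/rowP => i0; rewrite mxE.
apply/eqP/negP => /negP vi0.
(* Take an [r]-greatest index [i] in the support of the kernel vector [v]. In column [i] of the
   product only the diagonal term survives, which forces [v 0 i = 0]. *)
have [] := @extremumP _ _ (fun x y => r y x) i0 (fun i => v 0 i != 0) enum_val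
  r_refl _ _ vi0.
- by move=> y x z ryx rzy; exact: r_trans rzy ryx.
- by move=> x y; exact: r_total.
move=> i vi_neq0 i_max.
have := congr1 (fun M : 'rV_ _ => M 0 i) vAB0.
rewrite !mxE (bigD1 i) //= big1 => [/eqP|k ki].
  by rewrite addr0 mulf_eq0 (negPf vi_neq0) AB (negPf (diag _ (enum_valP i))).
have [->|vk_neq0] := eqVneq (v 0 k) 0; first by rewrite mul0r.
rewrite AB upper ?mulr0 ?enum_valP //; first exact: i_max.
by rewrite (inj_eq enum_val_inj).
Qed.

(* The tensor product of the functionals given by [moment_weights], whose value
   at a monomial not above [a] vanishes in some factor. *)
Lemma box_functional (K : fieldType) (n : nat) (Z : {fset K})
    (A : 'I_n -> {fset K}) (a : 'X_{1..n}) :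
  (forall i, A i `<=` Z) -> (forall i, (a i < #|` A i|)%N) ->
  exists2 W : {ffun 'I_n -> Z} -> K,
    forall y, W y != 0 -> forall i, val (y i) \in A i &
    forall p : {mpoly K[n]},
      (forall m, m \in msupp p -> (a <= m)%MM -> m = a) ->
      \sum_(y : {ffun 'I_n -> Z}) p.@[fun i => val (y i)] * W y = p@_a.
Proof.
move=> sAZ lt_aA.
have /fin_all_exists[w0 w0E] i := moment_weights (fset_uniq (A i)) (lt_aA i).
(* Extension by zero confines the functional to the box of the [A i], while its points keep
   coordinates in the common set [Z]. *)
pose w i x := if x \in A i then w0 i x else 0.
have wE i j : (j <= a i)%N -> \sum_(z : Z) w i (val z) * val z ^+ j = (j == a i)%:R.
  move=> le_ja; rewrite -w0E ?(leq_ltn_trans le_ja) //.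
  rewrite -(big_seq_fsetE _ Z xpredT (fun z => w i z * z ^+ j)) /=.
  rewrite -(@big_fset_incl _ _ _ _ (A i)) //.
    by rewrite [LHS]big_seq [RHS]big_seq; apply: eq_bigr => x xA; rewrite /w xA.
  by move=> x _ xA; rewrite /w (negPf xA) mul0r.
exists (fun y => \prod_i w i (val (y i))).
  move=> y /prodf_neq0 wy_neq0 i; have := wy_neq0 i isT.
  by rewrite /w; case: ifP => //; rewrite eqxx.
move=> p p_a.
have mE m : m \in msupp p ->
    \sum_(y : {ffun 'I_n -> Z})
      (\prod_i val (y i) ^+ m i) * \prod_i w i (val (y i)) = (m == a)%:R.
  move=> m_p.
  transitivity (\prod_i \sum_(z : Z) w i (val z) * val z ^+ m i).
    rewrite bigA_distr_bigA; apply: eq_bigr => y _.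
    by rewrite -big_split; apply: eq_bigr => i _; rewrite mulrC.
  have [->|m_neq_a] := eqVneq m a.
    by rewrite big1 // => i _; rewrite wE ?eqxx.
  have /forallPn[i] : ~~ [forall i, (a i <= m i)%N].
    apply: contra_neqN m_neq_a => /forallP le_am.
    by apply: p_a => //; apply/mnm_lepP.
  by rewrite -ltnNge => lt_ma; rewrite (bigD1 i) //= wE 1?ltnW // ltn_eqF // mul0r.
under eq_bigr do rewrite mevalE mulr_suml.
rewrite exchange_big /= big_seq.
under eq_bigr => m m_p.
  under eq_bigr do rewrite -mulrA.
  rewrite -mulr_sumr mE //.
over.
rewrite -big_seq; have [a_p|a_p] := boolP (a \in msupp p).
  rewrite (bigD1_seq a) //= eqxx mulr1 big1 ?addr0 // => m /negPf->.
  by rewrite mulr0.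
rewrite big_seq big1 ?memN_msupp_eq0 // => m m_p.
by case: eqP a_p => [<-|_ _]; rewrite ?m_p ?mulr0.
Qed.

Lemma lead_monomial_mulX (K : fieldType) (n : nat) (le : rel 'X_{1..n})
    (g : {mpoly K[n]}) (e c : 'X_{1..n}) :
  admissible le -> is_lead_monomial le g e ->
  is_lead_monomial le (g * 'X_[c]) (e + c)%MM.
Proof.
move=> le_adm [e_g e_max]; split.
  by rewrite mcoeff_msupp addmC mcoeffMX -mcoeff_msupp.
move=> m; rewrite (perm_mem (msuppMX _ _)) => /mapP[m' m'_g ->].
by rewrite addmC; apply: (adm_add le_adm); exact: e_max.
Qed.

Lemma card_ord_range (N l h : nat) :
  (h <= N)%N -> #|[pred k : 'I_N | (l <= k < h)%N]| = (h - l)%N.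
Proof.
move=> le_hN.
rewrite -[RHS]muln1 -sum_nat_const_nat -sum1_card (big_nat_widenl _ 0) //.
rewrite (big_nat_widen _ _ _ _ _ le_hN) big_mkord.
by under [RHS]eq_bigl do rewrite andTb.
Qed.

Theorem theorem9p4 (K : fieldType) (n : nat) (n_gt0 : (0 < n)%N)
    (X Y : 'I_n -> {fset K}) (sYX : forall i, Y i `<=` X i)
    (f : {mpoly K[n]}) (le : rel 'X_{1..n}) (le_adm : admissible le)
    (g : {mpoly K[n]}) (e : 'X_{1..n}) :
  let P := box X `\` box Y in
  let a i := #|` X i| in
  let b i := #|` Y i| in
  ideal_sum (vanishing_ideal P) (principal_ideal f) g ->
  is_lead_monomial le g e ->
  (forall i, (e i < a i)%N) ->
  \prod_(i < n) ((a i)%:Z - (e i)%:Z)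
    - \prod_(i < n) Num.min (b i)%:Z ((a i)%:Z - (e i)%:Z)
  <= #|` [fset x in P | x \notin zero_locus f]|%:Z.
Proof.
move=> P a b g_ideal g_e lt_ea.
(* A single finite set of coordinates and, below, a single bound [N] on exponents turn points and
   exponents into finite function types. *)
pose Z := \bigcup_(i <- index_enum 'I_n) X i.
have sXZ i : X i `<=` Z by apply: bigfcup_sup; rewrite ?mem_index_enum.
pose pt (y : {ffun 'I_n -> Z}) : {ffun 'I_n -> K} := [ffun i => val (y i)].
have pt_inj : injective pt.
  by move=> y y' /ffunP yy'; apply/ffunP => i; have := yy' i;
    rewrite !ffunE => /val_inj.
pose S := [set y | (pt y \in P) && (g.@[pt y] != 0)].
pose N := \max_i a i.
have leN i : (a i <= N)%N by exact: leq_bigmax.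
pose D1 : {set {ffun 'I_n -> 'I_N}} :=
  [set t in family (fun i => [pred k : 'I_N | (e i <= k < a i)%N])].
(* These are the exponents to discard: outside [D2], an element of [D1] has some
   [t i < a i - b i]. *)
pose D2 : {set {ffun 'I_n -> 'I_N}} :=
  [set t in family (fun i =>
     [pred k : 'I_N | (maxn (e i) (a i - b i) <= k < a i)%N])].
have cardD1 : #|D1| = (\prod_i (a i - e i))%N.
  rewrite cardsE card_family foldrE big_map big_enum; apply: eq_bigr => i _.
  exact: card_ord_range.
(* [a - max e (a - b) = min b (a - e)] *)
have cardD2 : #|D2| = (\prod_i minn (b i) (a i - e i))%N.
  rewrite cardsE card_family foldrE big_map big_enum; apply: eq_bigr => i _.
  rewrite card_ord_range //.
  have := fsubset_leq_card (sYX i); have := lt_ea i; rewrite -/(a i) -/(b i); lia.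
have leSf : (#|S| <= #|` [fset x in P | x \notin zero_locus f]|)%N.
  rewrite cardE -(size_map pt); apply: uniq_leq_size.
    by rewrite map_inj_uniq ?enum_uniq.
  move=> _ /mapP[y + ->]; rewrite mem_enum inE => /andP[yP gy].
  rewrite in_fset inE /= yP inE; apply: contraNN gy => /eqP fy0.
  have [h [_ [h0 [q ->] ->]]] := g_ideal.
  by rewrite mevalD mevalM fy0 mulr0 addr0 h0.
pose mn (t : {ffun 'I_n -> 'I_N}) : 'X_{1..n} := [multinom (t i : nat) | i < n].
have mn_inj : injective mn.
  move=> t t' /mnmP tt'; apply/ffunP => i; apply: val_inj.
  by have := tt' i; rewrite !mnmE.
pose D := D1 :\: D2.
have lead t : t \in D -> is_lead_monomial le (g * 'X_[mn t - e]) (mn t).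
  rewrite !inE => /andP[_ /familyP tD1].
  have le_et : (e <= mn t)%MM.
    by apply/mnm_lepP => i; have := tD1 i; rewrite mnmE inE => /andP[].
  by have := lead_monomial_mulX (mn t - e) le_adm g_e; rewrite addmC submK.
have leDS : (#|D| <= #|S|)%N.
  (* [W] represents a functional on functions on [P], extended by zero, that reads off the
     coefficient at [mn t]. *)
  pose good t := fun W : {ffun 'I_n -> Z} -> K =>
    (forall y, pt y \notin P -> W y = 0) /\
    forall p : {mpoly K[n]},
      (forall m, m \in msupp p -> (mn t <= m)%MM -> m = mn t) ->
      \sum_y p.@[pt y] * W y = p@_(mn t).
  have /fin_all_exists[W WP] t : exists W, t \in D -> good t W.
    have [tD|] := boolP (t \in D); last by exists (fun=> 0).
    move: tD; rewrite !inE => /andP[tD2 /familyP tD1].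
    have /existsP[i0] : [exists i, (t i < a i - b i)%N].
      apply: contraNT tD2 => /existsPn le_abt; apply/familyP => i.
      have := tD1 i; have := le_abt i; rewrite !inE /= geq_max -leqNgt.
      by move=> -> /andP[-> ->].
    move=> lt_tab; pose A i := if i == i0 then X i `\` Y i else X i.
    have sAX i : A i `<=` X i by rewrite /A; case: ifP => // _; exact: fsubsetDl.
    have lt_tA i : (mn t i < #|` A i|)%N.
      rewrite mnmE /A; case: eqP => [->|_].
        by rewrite cardfsD (fsetIidPr (sYX i0)).
      by have := tD1 i; rewrite !inE => /andP[].
    have [W W_supp WE] :=
      box_functional (fun i => fsubset_trans (sAX i) (sXZ i)) lt_tA.
    exists W => _; split=> [y yP|p p_t].
      apply: contraNeq yP => /W_supp yA; rewrite in_fsetD; apply/andP; split.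
        apply/in_box => /(_ i0); have := yA i0.
        by rewrite ffunE /A eqxx in_fsetD => /andP[/negPf->].
      by apply/in_box => i; rewrite ffunE; exact: (fsubsetP (sAX i)).
    rewrite -WE //; apply: eq_bigr => y _; congr (_ * _).
    by apply: meval_eq => i; rewrite ffunE.
  pose u t y := (g * 'X_[mn t - e]).@[pt y].
  (* Restricting the sum to [S] loses nothing: [W t] vanishes off [P], and [g] vanishes on the rest
     of [P]. Support monomials are at most [mn s], hence at most [mn t], so by antisymmetry one
     componentwise above [mn t] equals it. *)
  have uW s t : s \in D -> t \in D -> le (mn s) (mn t) ->
      \sum_(y in S) u s y * W t y = (g * 'X_[mn s - e])@_(mn t).
    move=> sD tD le_st; have [W_supp WE] := WP _ tD.
    rewrite -WE => [|m m_g le_tm].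
      rewrite big_mkcond; apply: eq_bigr => y _; rewrite inE.
      have [yP|/W_supp->] := boolP (pt y \in P); last by rewrite mulr0.
      by case: eqP => //= gy0; rewrite mevalM gy0 !mul0r.
    have [_ /(_ _ m_g) le_ms] := lead s sD.
    apply: (adm_anti le_adm); rewrite (adm_lepm le_adm le_tm) andbT.
    exact: (adm_trans le_adm) le_ms le_st.
  apply: (@triangular_card K _ _ D S (fun s t => le (mn s) (mn t)) u W).
  - by move=> t; exact: adm_refl.
  - by move=> t s s'; exact: adm_trans.
  - by move=> s t; exact: adm_total.
  (* A diagonal entry is the leading coefficient of the product. *)
  - move=> t tD; rewrite uW ?(adm_refl le_adm) // -mcoeff_msupp.
    by have [] := lead t tD.
  (* A nonzero entry would put [mn t] in the support, hence below the leading monomial [mn s], so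
     that [s = t]. *)
  move=> s t sD tD le_st; rewrite uW //; apply: contraNeq.
  rewrite -mcoeff_msupp => t_g; have [_ /(_ _ t_g) le_ts] := lead s sD.
  by apply/eqP/mn_inj/(adm_anti le_adm); rewrite le_st.
have sD21 : D2 \subset D1.
  apply/subsetP => t; rewrite !inE => /familyP tD2; apply/familyP => i.
  by have := tD2 i; rewrite !inE geq_max => /andP[/andP[-> _] ->].
have prod1 : \prod_(i < n) ((a i)%:Z - (e i)%:Z) = #|D1|%:Z.
  rewrite cardD1 -[RHS]natz natr_prod; apply: eq_bigr => i _.
  by rewrite natz subzn // ltnW.
have prod2 : \prod_(i < n) Num.min (b i)%:Z ((a i)%:Z - (e i)%:Z) = #|D2|%:Z.
  rewrite cardD2 -[RHS]natz natr_prod; apply: eq_bigr => i _.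
  rewrite natz; have := lt_ea i; lia.
have := cardsD D1 D2; rewrite (setIidPr sD21) -/D => cardD.
rewrite prod1 prod2; have := subset_leq_card sD21; lia.
Qed.
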